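(* Let $0 < \delta < 1$ and $0 < \alpha < \beta$ with $\frac{\alpha}{\beta} + \frac{\alpha}{2} \leq \frac{1}{2}$. Let $X_1, X_2, \ldots$ be a sequence of independent and identically distributed Bernoulli random variables having the same distribution as $X$, where $\Pr\{X = 1\} = 1 - \Pr\{X = 0\} = p \in (0,1)$. Define $\widehat{p}_n = \frac{1}{n}\sum_{i=1}^n X_i$ for $n \in \mathbb{N}$. Then $$\Pr\left\{ |\widehat{p}_n - p| < \alpha \ \text{ or } \ \left|\frac{\widehat{p}_n - p}{p}\right| < \beta \right\} > 1 - \delta$$ provided that $$n > \frac{\beta \ln\frac{2}{\delta}}{\alpha(1+\beta)\ln(1+\beta) + (\beta - \alpha - \alpha\beta)\ln\left(1 - \frac{\alpha\beta}{\beta - \alpha}\right)}.$$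
   Context: $\mathbb{N}$ denotes the set of positive integers, $\ln$ the natural logarithm, and $\Pr\{\cdot\}$ the probability of an event. *)

(* Defs.v *)
From HB Require Import structures.
From mathcomp Require Import all_boot all_order all_algebra finmap.
From mathcomp Require Import all_classical all_reals all_analysis.

Set Implicit Arguments.
Unset Strict Implicit.
Unset Printing Implicit Defensive.

Import Order.TTheory GRing.Theory Num.Theory.

Local Open Scope classical_set_scope.
Local Open Scope ring_scope.

(* Mutual independence: the product rule over every finite subfamily. *)
Definition mutually_independent (d d' : measure_display)
    (T : measurableType d) (T' : measurableType d') (R : realType)
    (P : probability T R) (I : choiceType) (X : I -> {RV P >-> T'}) : Prop :=
  forall (J : {fset I}) (B : I -> set T'), (forall i, measurable (B i)) ->
    P (\bigcap_(i in [set` J]) X i @^-1` B i) =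
    (\prod_(i <- J) P (X i @^-1` B i))%E.

Arguments mutually_independent {d d' T T' R} P {I} X.

(* The laws are compared on measurable sets only, since a library measure also
   takes (irrelevant) values on non-measurable ones. *)
Definition same_distribution (d d' : measure_display)
    (T : measurableType d) (T' : measurableType d') (R : realType)
    (P : probability T R) (X Y : {RV P >-> T'}) : Prop :=
  forall B : set T', measurable B -> distribution P X B = distribution P Y B.

Arguments same_distribution {d d' T T' R} P X Y.

(* Sequences are indexed from 0: [X i] stands for the usual X_{i+1}, so this is
   the mean of the first n terms. *)
Definition sample_mean (d : measure_display) (T : measurableType d)
    (R : realType) (P : probability T R) (X : nat -> {RV P >-> R}) (n : nat)
    (t : T) : R :=
  (n%:R)^-1 * \sum_(i < n) X i t.

Arguments sample_mean {d T R} P X n t.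

(* Main.v *)
(* With x = alpha / beta and y = x + alpha, the denominator is beta K, where
   K = KL(y || x), so it suffices to bound both tails at distance
   eps = max(alpha, beta p) from p by exp(- n K).  The Chernoff tilts s and - s,
   where s is the one that is optimal for moving x to y, work for every p: the
   upper exponent s (p + eps) - ln(1 - p + p e^s) is convex in p and equal to K at
   p = x.  For p <= x it has eps = alpha, and its slope at x is nonpositive as
   logit y - logit x <= (y - x) / (x (1 - x)); for p >= x it has eps = beta p and
   vanishes at p = 0, so it is nondecreasing from x on.  Since x <= 1/2, the lower
   exponent dominates the upper one for p <= x, and is then propagated along
   p >= x by the same convexity argument. *)
Require Import Defs.
From HB Require Import structures.
From mathcomp Require Import all_boot all_order all_algebra finmap.
From mathcomp Require Import all_classical all_reals all_analysis.
From mathcomp Require Import measurable_realfun ring lra.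

Set Implicit Arguments.
Unset Strict Implicit.
Unset Printing Implicit Defensive.

Import Order.TTheory GRing.Theory Num.Theory.
Import numFieldNormedType.Exports.

Local Open Scope classical_set_scope.
Local Open Scope ring_scope.

(** * Inequalities for the logarithm and the logit *)

Lemma ln_le_tangent (R : realType) (x y : R) : 0 < x -> 0 < y ->
  ln y <= ln x + (y - x) / x.
Proof.
move=> x0 y0; rewrite -lerBlDl -ln_div// mulrBl divff ?gt_eqF//.
rewrite -{1}(subrKC 1 (y / x)) le_ln1Dx// ltrBrDl subrr divr_gt0//.
Qed.

Lemma ln_lt_tangent1 (R : realType) (y : R) : 0 < y -> y != 1 -> ln y < y - 1.
Proof.
move=> y0 y1; rewrite ltrBrDl -{2}(lnK y0) expR_gt1Dx//.
by rewrite -ln1 (inj_in_eq (@ln_inj R)) ?posrE.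
Qed.

(** Mean value theorem for the logit, whose derivative at [z] is [1 / (z (1 - z))]; since
    [x <= z <= 1 - x], one has [z (1 - z) >= x (1 - x)]. *)
Lemma logit_le (R : realType) (x y : R) : 0 < x -> x < y -> x + y <= 1 ->
  ln (y * (1 - x) / (x * (1 - y))) <= (y - x) / (x * (1 - x)).
Proof.
move=> x0 xy xy1.
have d z : x <= z <= y -> is_derive z 1 (fun u : R => ln u - ln (1 - u))
    (z^-1 + (1 - z)^-1).
  move=> /andP[xz zy].
  have z0 : 0 < z by lra.
  have z1 : 0 < 1 - z by lra.
  have ? := is_derive1_ln z0; have ? := is_derive1_ln z1.
  have ? := @is_derive1_comp R (@ln R) (fun u => 1 - u) z _ _ _ _.
  apply: is_derive_eq.
  by rewrite ?scaler1; rewrite /GRing.scale/=; ring.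
have doo z : z \in `]x, y[ -> is_derive z 1 (fun u : R => ln u - ln (1 - u))
    (z^-1 + (1 - z)^-1).
  by rewrite in_itv /= => /andP[xz zy]; apply: d; rewrite !ltW.
have c : {within `[x, y], continuous (fun u : R => ln u - ln (1 - u))}.
  apply: continuous_in_subspaceT => z /[!inE]/=; rewrite in_itv /= => /d dz.
  by apply/differentiable_continuous/derivable1_diffP; apply: ex_derive.
have [z] := MVT xy doo c.
rewrite in_itv /= => /andP[xz zy] E.
have -> : ln (y * (1 - x) / (x * (1 - y))) = ln y - ln (1 - y) - (ln x - ln (1 - x)).
  by rewrite ln_div ?posrE ?lnM ?posrE ?mulr_gt0//; lra.
rewrite E mulrC ler_wpM2l//; first lra.
have -> : z^-1 + (1 - z)^-1 = (z * (1 - z))^-1 by field; apply/andP; split; lra.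
rewrite lef_pV2 ?posrE ?mulr_gt0//; nra.
Qed.

(* The derivative in [s] of the difference of the two sides has the sign of
   [(1 - p) (1 - 2 p) (cosh s - 1)]. *)
Lemma bernoulli_cgf_skew (R : realType) (p s : R) : 0 < p -> p <= 1 / 2 -> 0 <= s ->
  ln (1 + p * (expR (- s) - 1)) + 2 * s * p <= ln (1 + p * (expR s - 1)).
Proof.
move=> p0 p2 s0.
pose f (u : R) := ln (1 + p * (expR u - 1)) - ln (1 + p * (expR (- u) - 1)) - 2 * p * u.
pose df (u : R) := p * expR u / (1 + p * (expR u - 1))
  + p * expR (- u) / (1 + p * (expR (- u) - 1)) - 2 * p.
have pos u : 0 < 1 + p * (expR u - 1) by have := expR_gt0 u; nra.
have d (z : R) : is_derive z 1 f (df z).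
  have ? := is_derive1_ln (pos z); have ? := is_derive1_ln (pos (- z)).
  have ? := @is_derive1_comp R (@expR R) (fun u => - u) z _ _ _ _.
  have ? := @is_derive1_comp R (@ln R) (fun u => 1 + p * (expR u - 1)) z _ _ _ _.
  have ? := @is_derive1_comp R (@ln R) (fun u => 1 + p * (expR (- u) - 1)) z _ _ _ _.
  rewrite /f; apply: is_derive_eq.
  rewrite /df /GRing.scale/=; ring.
have c : {within `[0, s], continuous f}.
  apply: continuous_subspaceT => z.
  by apply/differentiable_continuous/derivable1_diffP; apply: ex_derive.
have [z _] := MVT_segment s0 (fun z _ => d z) c.
rewrite {1 2}/f oppr0 !(expR0, subrr, mulr0, addr0, ln1, subr0) => E.
suff : 0 <= df z * s by rewrite -E; lra.
apply: mulr_ge0 => //.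
rewrite /df expRN; have := expR_gt0 z; set e := expR z => e0.
have pe := pos z; rewrite -/e in pe.
have pe' : 0 < e + p * (1 - e).
  have : 0 < (1 - p) * e by rewrite mulr_gt0//; lra.
  lra.
have -> : p * e / (1 + p * (e - 1)) + p * e^-1 / (1 + p * (e^-1 - 1)) - 2 * p =
  p * (1 - p) * (1 - 2 * p) * (e - 1) ^+ 2 / ((1 + p * (e - 1)) * (e + p * (1 - e))).
  by field; rewrite !gt_eqF.
apply: divr_ge0; last exact: mulr_ge0 (ltW pe) (ltW pe').
by apply: mulr_ge0 (sqr_ge0 _); apply: mulr_ge0; [apply: mulr_ge0|]; lra.
Qed.

(** * Cumulants, relative entropy and tilting *)

Definition bernoulli_cgf (R : realType) (p s : R) : R := ln (1 + p * (expR s - 1)).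

Definition bernoulli_kl (R : realType) (y x : R) : R :=
  y * ln (y / x) + (1 - y) * ln ((1 - y) / (1 - x)).

(* The exponential change of measure taking Bernoulli [x] to Bernoulli [y]. *)
Definition tilt (R : realType) (x y : R) : R := ln (y * (1 - x) / (x * (1 - y))).

Lemma bernoulli_mgf_gt0 (R : realType) (p s : R) : 0 <= p -> p < 1 ->
  0 < 1 + p * (expR s - 1).
Proof. by move=> ? ?; have := expR_gt0 s; nra. Qed.

(** As the logarithm of an affine function of [p], the cumulant function is concave in [p], hence
    below its tangent at [x]. *)
Lemma bernoulli_cgf_tangent (R : realType) (x p s : R) :
  0 <= x -> x < 1 -> 0 <= p -> p < 1 ->
  bernoulli_cgf p s <=
    bernoulli_cgf x s + (p - x) * ((expR s - 1) / (1 + x * (expR s - 1))).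
Proof.
move=> x0 x1 p0 p1; rewrite /bernoulli_cgf.
have mx := @bernoulli_mgf_gt0 R x s x0 x1; have mp := @bernoulli_mgf_gt0 R p s p0 p1.
apply: (le_trans (ln_le_tangent mx mp)); rewrite lerD2l mulrA ler_pM2r ?invr_gt0//; lra.
Qed.

(** The exponent [c * p - bernoulli_cgf p s] is convex in [p] and vanishes at [p = 0], so once
    nonnegative at [x] it cannot decrease afterwards. The sign of [s] is free, which serves both
    tails. *)
Lemma bernoulli_exponent_ray (R : realType) (c s x p : R) :
  0 < x -> x <= p -> p < 1 -> 0 <= c * x - bernoulli_cgf x s ->
  c * x - bernoulli_cgf x s <= c * p - bernoulli_cgf p s.
Proof.
move=> x0 xp p1 pos.
pose t := (expR s - 1) / (1 + x * (expR s - 1)).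
have Tp : bernoulli_cgf p s <= bernoulli_cgf x s + (p - x) * t.
  by apply: bernoulli_cgf_tangent; lra.
(* The tangent at [x], read at [p = 0]; with [pos] it gives [x * t <= c * x]. *)
have T0 : 0 <= bernoulli_cgf x s - x * t.
  have := @bernoulli_cgf_tangent R x 0 s.
  rewrite {1}/bernoulli_cgf mul0r addr0 ln1 sub0r mulNr; apply; lra.
have ct : t <= c by rewrite -(ler_pM2r x0); lra.
have : (p - x) * t <= (p - x) * c by rewrite ler_wpM2l ?subr_ge0.
lra.
Qed.

Lemma expR_tilt (R : realType) (x y : R) : 0 < x -> x < 1 -> 0 < y -> y < 1 ->
  expR (tilt x y) = y * (1 - x) / (x * (1 - y)).
Proof. by move=> *; rewrite lnK// posrE divr_gt0// mulr_gt0//; lra. Qed.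

Lemma tilt_ge0 (R : realType) (x y : R) : 0 < x -> x < y -> y < 1 -> 0 <= tilt x y.
Proof.
by move=> x0 xy y1; apply: ln_ge0; rewrite ler_pdivlMr ?mulr_gt0//; nra.
Qed.

(** Legendre duality between cumulant function and relative entropy, with [tilt x y] as the
    maximiser; there the normalising factor is [(1 - x) / (1 - y)]. *)
Lemma bernoulli_kl_tilt (R : realType) (x y : R) : 0 < x -> x < y -> y < 1 ->
  bernoulli_kl y x = tilt x y * y - bernoulli_cgf x (tilt x y).
Proof.
move=> x0 xy y1; rewrite /bernoulli_cgf expR_tilt; try lra.
have -> : 1 + x * (y * (1 - x) / (x * (1 - y)) - 1) = (1 - x) / (1 - y).
  by field; apply/andP; split; lra.
rewrite /tilt /bernoulli_kl !ln_div ?posrE ?mulr_gt0//; try lra.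
by rewrite !lnM ?posrE//; try lra; ring.
Qed.

(** Gibbs' inequality: the strict tangent bounds for [ln (x / y)] and [ln ((1 - x) / (1 - y))],
    weighted by [y] and [1 - y], have right-hand sides [x - y] and [y - x], which cancel. *)
Lemma bernoulli_kl_gt0 (R : realType) (x y : R) : 0 < x -> x < y -> y < 1 ->
  0 < bernoulli_kl y x.
Proof.
move=> x0 xy y1.
have y0 : 0 < y by lra.
have y1' : 0 < 1 - y by lra.
have x1' : 0 < 1 - x by lra.
have /ln_lt_tangent1 L1 : 0 < x / y by rewrite divr_gt0.
have /ln_lt_tangent1 L2 : 0 < (1 - x) / (1 - y) by rewrite divr_gt0.
have {L1} : ln (x / y) < x / y - 1.
  by apply: L1; rewrite lt_eqF// ltr_pdivrMr// mul1r.
have {L2} : ln ((1 - x) / (1 - y)) < (1 - x) / (1 - y) - 1.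
  by apply: L2; rewrite gt_eqF// ltr_pdivlMr// mul1r; lra.
rewrite /bernoulli_kl !ln_div ?posrE// => L2 L1.
have : y * (ln x - ln y) < x - y.
  have -> : x - y = y * (x / y - 1) by field; lra.
  by rewrite ltr_pM2l.
have : (1 - y) * (ln (1 - x) - ln (1 - y)) < y - x.
  have -> : y - x = (1 - y) * ((1 - x) / (1 - y) - 1) by field; lra.
  by rewrite ltr_pM2l.
lra.
Qed.

(** * Exponents of the two tails *)

(** The tangent at [x] leaves the term [(p - x) * (tilt x y - t)], with [t] the slope of the
    cumulant function at [x]; both factors are nonpositive, the second by [logit_le]. *)
Lemma upper_exponent_abs (R : realType) (x y p : R) :
  0 < x -> x < y -> x + y <= 1 -> 0 < p -> p <= x ->
  bernoulli_kl y x <= tilt x y * (p + (y - x)) - bernoulli_cgf p (tilt x y).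
Proof.
move=> x0 xy xy1 p0 px.
rewrite bernoulli_kl_tilt; try lra.
have := @bernoulli_cgf_tangent R x p (tilt x y).
rewrite expR_tilt; try lra.
have -> : (y * (1 - x) / (x * (1 - y)) - 1) /
      (1 + x * (y * (1 - x) / (x * (1 - y)) - 1)) =
    (y - x) / (x * (1 - x)).
  by field; repeat (apply/andP; split); lra.
have L : tilt x y <= (y - x) / (x * (1 - x)) := logit_le x0 xy xy1.
have : (p - x) * ((y - x) / (x * (1 - x))) <= (p - x) * tilt x y.
  by apply: ler_wnM2l => //; lra.
move=> H T; have {}T := T _ _ _ _; lra.
Qed.

Lemma lower_exponent_ge_upper (R : realType) (p s eps : R) :
  0 < p -> p <= 1 / 2 -> 0 <= s ->
  s * (p + eps) - bernoulli_cgf p s <= - s * (p - eps) - bernoulli_cgf p (- s).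
Proof.
by move=> p0 p2 s0; have := bernoulli_cgf_skew p0 p2 s0; rewrite /bernoulli_cgf; lra.
Qed.

(** The threshold equals [(y / x) * p], linear in [p], so [bernoulli_exponent_ray] carries the value
    at [x] to every larger [p]. *)
Lemma upper_exponent_rel (R : realType) (x y p : R) :
  0 < x -> x < y -> y < 1 -> x <= p -> p < 1 ->
  bernoulli_kl y x <= tilt x y * (p + p * (y / x - 1)) - bernoulli_cgf p (tilt x y).
Proof.
move=> x0 xy y1 xp p1.
have K0 := bernoulli_kl_gt0 x0 xy y1.
have E := bernoulli_kl_tilt x0 xy y1.
have := @bernoulli_exponent_ray R (tilt x y * (y / x)) (tilt x y) x p x0 xp p1.
rewrite -mulrA divfK ?gt_eqF// -E => /(_ (ltW K0)); lra.
Qed.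

Lemma lower_exponent_rel (R : realType) (x y p : R) :
  0 < x -> x < y -> x + y <= 1 -> x <= p -> p < 1 ->
  bernoulli_kl y x <= - tilt x y * (p - p * (y / x - 1)) - bernoulli_cgf p (- tilt x y).
Proof.
move=> x0 xy xy1 xp p1.
have y1 : y < 1 by lra.
have K0 := bernoulli_kl_gt0 x0 xy y1.
have s0 := tilt_ge0 x0 xy y1.
(* At [p = x] the lower exponent dominates the upper one, which is the relative entropy;
   [x <= 1 / 2] follows from [x < y] and [x + y <= 1]. *)
have := @lower_exponent_ge_upper R x (tilt x y) (y - x) x0 _ s0.
rewrite [x + (y - x)]addrC subrK -bernoulli_kl_tilt// => H.
have {}H : bernoulli_kl y x <=
    - tilt x y * (2 - y / x) * x - bernoulli_cgf x (- tilt x y).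
  have -> : - tilt x y * (2 - y / x) * x = - tilt x y * (x - (y - x)) by field; lra.
  by apply: H; lra.
apply: (le_trans H).
have -> : - tilt x y * (p - p * (y / x - 1)) = - tilt x y * (2 - y / x) * p by ring.
by apply: bernoulli_exponent_ray => //; lra.
Qed.

(** * Chernoff bound on binary words *)

(** Product law of [n] Bernoulli variables on the finite cube, where tail bounds become finite
    sums. *)
Definition bernoulli_weight (R : realType) (p : R) n (w : {ffun 'I_n -> bool}) : R :=
  \prod_(i < n) (if w i then p else 1 - p).

Lemma bernoulli_weight_ge0 (R : realType) (p : R) n (w : {ffun 'I_n -> bool}) :
  0 <= p -> p <= 1 -> 0 <= bernoulli_weight p w.
Proof. by move=> p0 p1; apply: prodr_ge0 => i _; case: ifP => _; lra. Qed.

Lemma bernoulli_weight_mgf (R : realType) (p s : R) n :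
  \sum_(w : {ffun 'I_n -> bool})
     bernoulli_weight p w * expR (s * \sum_(i < n) (w i)%:R) =
  (1 + p * (expR s - 1)) ^+ n.
Proof.
transitivity (\prod_(i < n) \sum_(b : bool)
    ((if b then p else 1 - p) * expR (s * b%:R))).
  rewrite bigA_distr_bigA; apply: eq_bigr => w _.
  by rewrite mulr_sumr expR_sum big_split.
under eq_bigr do rewrite big_bool /= mulr1 mulr0 expR0.
rewrite prodr_const card_ord; congr (_ ^+ _); ring.
Qed.

Lemma bernoulli_weight_sum (R : realType) (p : R) n :
  \sum_(w : {ffun 'I_n -> bool}) bernoulli_weight p w = 1.
Proof.
have := bernoulli_weight_mgf p 0 n; rewrite expR0 subrr mulr0 addr0 expr1n => <-.
by apply: eq_bigr => w _; rewrite mul0r expR0 mulr1.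
Qed.

(* A negative [s] gives the lower tail. *)
Lemma bernoulli_weight_chernoff (R : realType) (p s c : R) n : 0 <= p -> p < 1 ->
  \sum_(w : {ffun 'I_n -> bool} | s * (n%:R * c) <= s * \sum_(i < n) (w i)%:R)
     bernoulli_weight p w
  <= expR (- (n%:R * (s * c - bernoulli_cgf p s))).
Proof.
move=> p0 p1.
(* Exponential Markov inequality: the bound is an exponential moment summed over all words, whose
   exponential factor is at least 1 on the event. *)
have -> : expR (- (n%:R * (s * c - bernoulli_cgf p s))) =
    \sum_(w : {ffun 'I_n -> bool}) bernoulli_weight p w *
       expR (s * \sum_(i < n) (w i)%:R - s * (n%:R * c)).
  under eq_bigr do rewrite expRD mulrA.
  rewrite -mulr_suml bernoulli_weight_mgf.
  rewrite -[X in X ^+ n](@lnK R) ?posrE ?bernoulli_mgf_gt0//.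
  by rewrite -expRM_natl -expRD /bernoulli_cgf; congr (expR _); ring.
rewrite big_mkcond/=; apply: ler_sum => w _; case: ifP => [le|_].
  rewrite ler_peMr ?bernoulli_weight_ge0 ?(ltW p1)//.
  by rewrite -[leLHS]expR0 ler_expR subr_ge0.
by rewrite mulr_ge0 ?expR_ge0 ?bernoulli_weight_ge0// ltW.
Qed.

(** * From binary words to the probability space *)

Lemma bernoulli_cylinder_prob (R : realType) (d : measure_display)
    (T : measurableType d) (P : probability T R) (p : R)
    (Xs : nat -> {RV P >-> R}) (n : nat) (w : {ffun 'I_n -> bool}) :
  mutually_independent P Xs ->
  (forall i, P (Xs i @^-1` [set 1]) = p%:E) ->
  (forall i, P (Xs i @^-1` [set 0]) = (1 - p)%:E) ->
  P [set t | forall i : 'I_n, Xs i t = (w i)%:R] = (bernoulli_weight p w)%:E.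
Proof.
move=> ind X1 X0.
(* Independence asks for a set at every natural index; those from [n] on get [setT], while the
   product runs only over [0, ..., n - 1]. *)
pose B (i : nat) : set R := if insub i is Some j then [set (w j)%:R] else setT.
have BE (i : 'I_n) : B i = [set (w i)%:R] by rewrite /B valK.
have mB i : measurable (B i) by rewrite /B; case: insubP.
have := ind (seq_fset tt (iota 0 n)) B mB.
rewrite (perm_big (iota 0 n)); last first.
  by rewrite uniq_perm ?fset_uniq ?iota_uniq// => i; rewrite seq_fsetE.
rewrite -{2}[n]subn0 -/(index_iota 0 n) big_mkord.
under eq_bigr do rewrite BE.
rewrite (_ : \bigcap_(i in _) _ = [set t | forall i : 'I_n, Xs i t = (w i)%:R]).
  move=> ->; rewrite /bernoulli_weight -prodEFin; apply: eq_bigr => i _.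
  by case: (w i).
apply/seteqP; split => t H i.
  have iJ : (i : nat) \in seq_fset tt (iota 0 n) by rewrite seq_fsetE mem_iota add0n/=.
  by have := H i iJ; rewrite BE.
move=> iJ; have : (i : nat) \in seq_fset tt (iota 0 n) := iJ.
rewrite seq_fsetE mem_iota add0n => iltn.
by rewrite /preimage/= (BE (Ordinal iltn)); exact: (H (Ordinal iltn)).
Qed.

(** The cylinders of the words in [Q] are disjoint subsets of [A]. Only a lower bound results: [A]
    may also contain other words, and points where some [Xs i] is neither 0 nor 1. *)
Lemma bernoulli_weight_le_prob (R : realType) (d : measure_display)
    (T : measurableType d) (P : probability T R) (p : R)
    (Xs : nat -> {RV P >-> R}) (n : nat) (Q : pred {ffun 'I_n -> bool}) (A : set T) :
  mutually_independent P Xs ->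
  (forall i, P (Xs i @^-1` [set 1]) = p%:E) ->
  (forall i, P (Xs i @^-1` [set 0]) = (1 - p)%:E) ->
  measurable A ->
  (forall w t, Q w -> (forall i : 'I_n, Xs i t = (w i)%:R) -> A t) ->
  ((\sum_(w | Q w) bernoulli_weight p w)%:E <= P A)%E.
Proof.
move=> ind X1 X0 mA QA.
pose F (w : {ffun 'I_n -> bool}) := [set t | forall i : 'I_n, Xs i t = (w i)%:R].
have mF w : measurable (F w).
  rewrite (_ : F w = \bigcap_(i in [set: 'I_n]) (Xs i @^-1` [set (w i)%:R])).
    apply: fin_bigcap_measurable => [|i _]; first exact: finite_finset.
    exact: measurable_funPTI.
  by apply/seteqP; split => t /= H i => [_|]; apply: H.
have <- : P (\bigcup_(w in [set` enum Q]) F w) =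
    (\sum_(w | Q w) bernoulli_weight p w)%:E.
  rewrite measure_fin_bigcup//; last first.
    move=> v w _ _ [t [Fv Fw]]; apply/ffunP => i.
    have := Fv i; rewrite (Fw i) => /eqP; rewrite eqr_nat.
    by case: (v i) (w i) => [] [].
  rewrite -fsbig_seq ?enum_uniq// big_enum/= -sumEFin; apply: eq_bigr => w _.
  exact: bernoulli_cylinder_prob.
apply: le_measure; rewrite ?inE//.
  by apply: fin_bigcup_measurable.
by move=> t [w /=]; rewrite mem_enum => Qw; exact: QA.
Qed.

Lemma measurable_sample_mean (R : realType) (d : measure_display)
    (T : measurableType d) (P : probability T R) (Xs : nat -> {RV P >-> R}) (n : nat) :
  measurable_fun setT (sample_mean P Xs n).
Proof.
by apply: measurable_funM => //; apply: measurable_sum => i; exact: measurable_funP.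
Qed.

Lemma measurable_norm_lt (R : realType) (d : measure_display)
    (T : measurableType d) (f : T -> R) (a : R) :
  measurable_fun setT f -> measurable [set t | `|f t| < a].
Proof.
move=> mf; have mnf : measurable_fun setT (fun t => `|f t|) by exact: measurableT_comp.
by have := mnf measurableT _ (measurable_itv `]-oo, a[); rewrite setTI.
Qed.

(** * Two-sided concentration and the mixed criterion *)

(** Union bound over the upper tail with tilt [s] and the lower tail with tilt [- s], both having
    exponent at least [K]. *)
Lemma bernoulli_weight_concentration (R : realType) (p s eps K : R) (n : nat) :
  0 < p -> p < 1 -> (0 < n)%N -> 0 <= s ->
  K <= s * (p + eps) - bernoulli_cgf p s ->
  K <= - s * (p - eps) - bernoulli_cgf p (- s) ->
  1 - 2 * expR (- (n%:R * K)) <=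
  \sum_(w : {ffun 'I_n -> bool} | `|n%:R^-1 * (\sum_(i < n) (w i)%:R) - p| < eps)
     bernoulli_weight p w.
Proof.
move=> p0 p1 n0 s0 Ku Kl.
have n0R : (0 : R) < n%:R by rewrite ltr0n.
pose m (w : {ffun 'I_n -> bool}) : R := \sum_(i < n) (w i)%:R.
pose good (w : {ffun 'I_n -> bool}) := `|n%:R^-1 * m w - p| < eps.
have := bernoulli_weight_sum p n; rewrite (bigID good)/= => sum1.
suff : \sum_(w | ~~ good w) bernoulli_weight p w <= 2 * expR (- (n%:R * K)).
  by move: sum1; rewrite /good /m; lra.
have w0 (w : {ffun 'I_n -> bool}) : 0 <= bernoulli_weight p w.
  by rewrite bernoulli_weight_ge0// ltW.
pose up (w : {ffun 'I_n -> bool}) := s * (n%:R * (p + eps)) <= s * m w.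
pose lo (w : {ffun 'I_n -> bool}) := - s * (n%:R * (p - eps)) <= - s * m w.
apply: (@le_trans _ _ (\sum_(w | up w) bernoulli_weight p w +
                       \sum_(w | lo w) bernoulli_weight p w)).
  rewrite (big_mkcond up) (big_mkcond lo) [leLHS]big_mkcond -big_split/=.
  apply: ler_sum => w _; have := w0 w; case: ifPn => [bad|_ _]; last first.
    by apply: addr_ge0; case: ifP.
  suff /orP[->|->] : up w || lo w by case: ifP => _; lra.
  move: bad; rewrite /good -leNgt ler_normr => /orP[h|h]; apply/orP; [left|right].
    apply: ler_wpM2l => //.
    have -> : m w = n%:R * (n%:R^-1 * m w) by rewrite mulrA divff ?mul1r ?gt_eqF.
    by rewrite ler_pM2l//; lra.
  apply: ler_wnM2l; first lra.
  have -> : m w = n%:R * (n%:R^-1 * m w) by rewrite mulrA divff ?mul1r ?gt_eqF.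
  by rewrite ler_pM2l//; lra.
have Bu := bernoulli_weight_chernoff s (p + eps) n (ltW p0) p1.
have Bl := bernoulli_weight_chernoff (- s) (p - eps) n (ltW p0) p1.
have Eu : expR (- (n%:R * (s * (p + eps) - bernoulli_cgf p s))) <= expR (- (n%:R * K)).
  by rewrite ler_expR lerN2 ler_pM2l.
have El : expR (- (n%:R * (- s * (p - eps) - bernoulli_cgf p (- s)))) <=
    expR (- (n%:R * K)).
  by rewrite ler_expR lerN2 ler_pM2l.
rewrite /up /lo /m; lra.
Qed.

(** The witness is the larger of the absolute and relative tolerances, which switch at [p = x]; the
    tilt stays the same for every [p]. *)
Lemma mixed_criterion_exponents (R : realType) (x y p : R) :
  0 < x -> x < y -> x + y <= 1 -> 0 < p -> p < 1 ->
  exists eps, [/\ eps = y - x \/ eps = p * (y / x - 1),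
    bernoulli_kl y x <= tilt x y * (p + eps) - bernoulli_cgf p (tilt x y) &
    bernoulli_kl y x <= - tilt x y * (p - eps) - bernoulli_cgf p (- tilt x y)].
Proof.
move=> x0 xy xy1 p0 p1; have y1 : y < 1 by lra.
have [px|/ltW xp] := leP p x.
  exists (y - x); split; [by left|exact: upper_exponent_abs|].
  apply: (le_trans (upper_exponent_abs x0 xy xy1 p0 px)).
  by apply: lower_exponent_ge_upper => //; [lra|exact: tilt_ge0].
exists (p * (y / x - 1)); split; [by right|exact: upper_exponent_rel|].
exact: lower_exponent_rel.
Qed.

Theorem theorem4 (R : realType) (d : measure_display) (T : measurableType d)
  (P : probability T R) (delta alpha beta p : R)
  (X : {RV P >-> R}) (Xs : nat -> {RV P >-> R}) (n : nat)
  (delta_gt0 : 0 < delta) (delta_lt1 : delta < 1)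
  (alpha_gt0 : 0 < alpha) (alpha_lt_beta : alpha < beta)
  (alpha_beta : alpha / beta + alpha / 2 <= 1 / 2)
  (p_gt0 : 0 < p) (p_lt1 : p < 1)
  (X_1 : P [set t | X t = 1] = p%:E)
  (X_0 : P [set t | X t = 0] = (1 - p)%:E)
  (Xs_indep : mutually_independent P Xs)
  (Xs_X : forall i : nat, same_distribution P (Xs i) X)
  (n_gt0 : (0 < n)%N)
  (n_large : n%:R >
     (beta * ln (2 / delta)) /
     (alpha * (1 + beta) * ln (1 + beta) +
      (beta - alpha - alpha * beta) *
        ln (1 - alpha * beta / (beta - alpha)))) :
  ((1 - delta)%:E <
   P [set t | `|sample_mean P Xs n t - p| < alpha \/
              `|(sample_mean P Xs n t - p) / p| < beta]%R)%E.
Proof.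
have beta_gt0 : 0 < beta by lra.
pose x := alpha / beta; pose y := x + alpha.
have x0 : 0 < x by rewrite divr_gt0.
have xy : x < y by rewrite ltrDl.
(* Twice [alpha_beta], as [x + y = 2 x + alpha]. *)
have xy1 : x + y <= 1 by rewrite /y; move: alpha_beta; rewrite -/x; lra.
have y1 : y < 1 by lra.
have y0 : 0 < y by lra.
have alphaE : alpha = x * beta by rewrite divfK ?gt_eqF.
have K0 := bernoulli_kl_gt0 x0 xy y1.
have yx : y / x - 1 = beta by rewrite /y alphaE; field; rewrite gt_eqF.
have denE : alpha * (1 + beta) * ln (1 + beta) + (beta - alpha - alpha * beta) *
    ln (1 - alpha * beta / (beta - alpha)) = beta * bernoulli_kl y x.
  have -> : 1 - alpha * beta / (beta - alpha) = (1 - y) / (1 - x).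
    by rewrite /y alphaE; field; apply/andP; split; nra.
  by rewrite -[1 + beta]addrC -{2}yx subrK /bernoulli_kl /y alphaE; ring.
move: n_large; rewrite denE ltr_pdivrMr ?mulr_gt0// mulrCA ltr_pM2l// => nK.
(* The factor 2 counts the two tails and is what puts [2 / delta] under the logarithm. *)
have small : 2 * expR (- (n%:R * bernoulli_kl y x)) < delta.
  rewrite -ltr_pdivlMl// [ltRHS]mulrC -[ltRHS](@lnK R) ?posrE ?divr_gt0// ltr_expR.
  by rewrite -[delta / 2]invf_div lnV ?posrE ?divr_gt0// ltrN2.
have X1 i : P (Xs i @^-1` [set 1]) = p%:E by rewrite -X_1; exact: (Xs_X i).
have X0 i : P (Xs i @^-1` [set 0]) = (1 - p)%:E by rewrite -X_0; exact: (Xs_X i).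
have [eps [epsE Ku Kl]] := mixed_criterion_exponents x0 xy xy1 p_gt0 p_lt1.
have C := bernoulli_weight_concentration p_gt0 p_lt1 n_gt0 (tilt_ge0 x0 xy y1) Ku Kl.
have mS := measurable_sample_mean Xs n.
apply: (@lt_le_trans _ _
  (\sum_(w : {ffun 'I_n -> bool} | `|n%:R^-1 * (\sum_(i < n) (w i)%:R) - p| < eps)
     bernoulli_weight p w)%:E).
  by rewrite lte_fin; lra.
apply: (bernoulli_weight_le_prob Xs_indep X1 X0).
  rewrite (_ : [set t | _] = [set t | `|sample_mean P Xs n t - p| < alpha] `|`
    [set t | `|(sample_mean P Xs n t - p) / p| < beta])//.
  apply: measurableU; apply: measurable_norm_lt.
    exact: measurable_funB.
  by apply: measurable_funM => //; exact: measurable_funB.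
move=> w t good Xw /=; rewrite /sample_mean.
have -> : \sum_(i < n) Xs i t = \sum_(i < n) (w i)%:R.
  by apply: eq_bigr => i _; exact: Xw.
(* For [eps = y - x = alpha] the absolute alternative holds; for [eps = p * beta] division by [p]
   gives the relative one. *)
case: epsE good => ->; first by rewrite /y addrAC subrr add0r; left.
rewrite yx => good; right.
by rewrite normrM normfV (gtr0_norm p_gt0) ltr_pdivrMr// [ltRHS]mulrC.
Qed.
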